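(* Let $G$ be a finite simple graph that does not contain a propeller as a subgraph. Then either $G\in\mathcal C_0$ (i.e., no node of $G$ has at least two neighbors of degree at least three), or $G$ has a 0-cutset, a 1-cutset, a proper $K_2$-cutset, or a proper $S_2$-cutset.
   Context: All graphs are finite, simple and undirected. A propeller $(C,x)$ is a graph consisting of a chordless cycle $C$ (the rim) and a node $x\notin V(C)$ (the center) that has at least two neighbors on $C$. $G$ contains $F$ (as a subgraph) if $F$ is isomorphic to a subgraph of $G$. $\mathcal C_0$ is the class of graphs in which no node has at least two neighbors of degree at least three. A set $S\subseteq V(G)$ is a node cutset if $G\setminus S$ has more than one connected component (so a 0-cutset means $G$ is disconnected); a $k$-cutset is a node cutset of size $k$. A 2-cutset $\{a,b\}$ is a $K_2$-cutset if $ab\in E(G)$, and an $S_2$-cutset otherwise. If $S$ is a node cutset, a split $(S,C_1,C_2)$ is a partition of $V(G)\setminus S$ into nonempty sets $C_1,C_2$ with no edge between $C_1$ and $C_2$. A $K_2$-cutset $S$ is proper if no node of $G\setminus S$ is adjacent to both nodes of $S$. An $S_2$-cutset $\{a,b\}$ is proper if it has a split $(\{a,b\},C_1,C_2)$ such that neither $G[\{a,b\}\cup C_1]$ nor $G[\{a,b\}\cup C_2]$ is a chordless $ab$-path. *)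

(* Defs.v *)
From mathcomp Require Import all_boot.

Set Implicit Arguments.
Unset Strict Implicit.
Unset Printing Implicit Defensive.

Record sgraph := SGraph {
  vertex :> finType;
  adj : rel vertex;
  adj_sym : symmetric adj;
  adj_irr : irreflexive adj }.

Section Basics.

Variable G : sgraph.
Implicit Types (x y u v a b : G) (c p : seq G) (S W : {set G}).

Definition nbrs x : {set G} := [set y | adj x y].

Definition degree x : nat := #|nbrs x|.

Definition is_cycle c : Prop := 2 < size c /\ ucycle (@adj G) c.

Definition chordless_cycle c : Prop :=
  is_cycle c /\
  {in c &, forall u v, adj u v -> v = next c u \/ u = next c v}.

(* The nodes of the path are those of a :: p, in this order. *)
Definition is_path a b p : Prop :=
  [/\ path (@adj G) a p, uniq (a :: p) & last a p = b].

Definition chordless_path a b p : Prop :=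
  is_path a b p /\
  {in a :: p &, forall u v, adj u v ->
    index v (a :: p) = (index u (a :: p)).+1 \/
    index u (a :: p) = (index v (a :: p)).+1}.

(* The subgraph induced by W is a chordless path from a to b: chords are taken
   with respect to all the edges of G, so only the node sets are compared. *)
Definition induces_chordless_path W a b : Prop :=
  exists2 p, chordless_path a b p & W = [set u in a :: p].

(* The node set W and the edge relation E form a subgraph of G, which need not
   be induced. *)
Definition is_subgraph W (E : rel G) : Prop :=
  symmetric E /\ (forall u v, E u v -> [/\ u \in W, v \in W & adj u v]).

Definition in_C0 : Prop :=
  forall x, ~ 2 <= #|[set y in nbrs x | 3 <= degree y]|.

End Basics.

Definition contains (G F : sgraph) : Prop :=
  exists (W : {set G}) (E : rel G), is_subgraph W E /\
  exists f : F -> G, [/\ injective f, f @: [set: F] = W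
                       & forall u v, E (f u) (f v) = adj u v].

Definition is_propeller (F : sgraph) : Prop :=
  exists (c : seq F) (x : F),
    [/\ chordless_cycle c, x \notin c,
        forall v : F, v = x \/ v \in c
      & 2 <= #|[set y in nbrs x | y \in c]|].

Definition contains_propeller (G : sgraph) : Prop :=
  exists2 F : sgraph, is_propeller F & contains G F.

Section Induced.

Variables (G : sgraph) (W : {set G}).

Definition induced_adj : rel {x : G | x \in W} :=
  fun u v => adj (val u) (val v).

Lemma induced_adj_sym : symmetric induced_adj.
Proof. by move=> u v; apply: adj_sym. Qed.

Lemma induced_adj_irr : irreflexive induced_adj.
Proof. by move=> u; apply: adj_irr. Qed.

Definition induced : sgraph := SGraph induced_adj_sym induced_adj_irr.

End Induced.

Definition num_components (G : sgraph) : nat := n_comp (@adj G) predT.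

Section Cutsets.

Variable G : sgraph.
Implicit Types (a b : G) (S : {set G}).

Definition node_cutset S : Prop := 1 < num_components (induced (~: S)).

Definition k_cutset (k : nat) S : Prop := node_cutset S /\ #|S| = k.

Definition has_k_cutset (k : nat) : Prop := exists S, k_cutset k S.

Definition is_split S (C1 C2 : {set G}) : Prop :=
  [/\ C1 != set0, C2 != set0, [disjoint C1 & C2], C1 :|: C2 = ~: S
    & {in C1 & C2, forall u v, ~~ adj u v}].

(* Since [set a; b] has two elements, a and b are distinct. *)
Definition K2_cutset a b : Prop := k_cutset 2 [set a; b] /\ adj a b.

Definition S2_cutset a b : Prop := k_cutset 2 [set a; b] /\ ~~ adj a b.

Definition proper_K2_cutset a b : Prop :=
  K2_cutset a b /\
  (forall x, x \notin [set a; b] -> ~ (adj x a /\ adj x b)).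

Definition proper_S2_cutset a b : Prop :=
  S2_cutset a b /\
  exists C1 C2 : {set G}, [/\ is_split [set a; b] C1 C2,
    ~ induces_chordless_path ([set a; b] :|: C1) a b
  & ~ induces_chordless_path ([set a; b] :|: C2) a b].

Definition has_proper_K2_cutset : Prop := exists a b, proper_K2_cutset a b.

Definition has_proper_S2_cutset : Prop := exists a b, proper_S2_cutset a b.

End Cutsets.

(* Main.v *)
(** Deleting the chords of the rim turns any cycle with an outside node having
    two neighbors on it into a propeller. Let x have two neighbors y and z of
    degree at least three, and assume that G - a is connected for every a. If
    no node w separates y from z in G - x, then y and z lie on a cycle of
    G - x, which together with x gives a propeller. Otherwise {x, w} is a
    cutset with y and z on different sides. If xw is not an edge, it is proper
    because an inner node of a chordless path has degree two. If xw is an edge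
    and v is adjacent to x and w, then the triangle xwv has the node x of
    degree at least three, and a path from a third neighbor of x back to the
    triangle closes a cycle that misses exactly one node of the triangle. *)
Require Import Defs.
From mathcomp Require Import all_boot.

Set Implicit Arguments.
Unset Strict Implicit.
Unset Printing Implicit Defensive.

(** * From cycles to propeller subgraphs *)

Lemma cycle_propeller (G : sgraph) (c : seq G) (x y z : G) :
  is_cycle c -> x \notin c -> y \in c -> z \in c -> y != z ->
  adj x y -> adj x z -> contains_propeller G.
Proof.
move=> [size_c /andP[cyc_c uniq_c]] xNc yc zc yz xy xz.
(* [e] keeps the edges at [x] and those joining consecutive nodes of [c]. As [x] is off [c], every
   chord of [c] is lost. *)
pose e (u v : G) := adj u v &&
  [|| u == x, v == x, v == next c u | u == next c v].
have e_sym : symmetric e.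
  by move=> u v; rewrite /e adj_sym orbCA (orbC (v == next c u)).
have e_irr : irreflexive e by move=> u; rewrite /e adj_irr.
pose V := {v : G | v \in x :: c}.
pose eV : rel V := fun u v => e (val u) (val v).
have eV_sym : symmetric eV by move=> u v; apply: e_sym.
have eV_irr : irreflexive eV by move=> u; apply: e_irr.
pose F := SGraph eV_sym eV_irr.
have xV : x \in x :: c by rewrite mem_head.
have cV v : v \in c -> v \in x :: c by rewrite inE orbC => ->.
pose cF : seq F := pmap insub c.
have cFE : map val cF = c.
  rewrite (pmap_filter (insubK _)); apply/all_filterP/allP => v vc.
  by rewrite isSome_insub cV.
have mem_cF (v : F) : (v \in cF) = (val v \in c).
  by rewrite -(mem_map val_inj) cFE.
have uniq_cF : uniq cF by rewrite -(map_inj_uniq val_inj) cFE.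
have next_cF (v : F) : val (next cF v) = next c (val v).
  by rewrite -(next_map val_inj) // cFE.
exists F.
  exists cF, (Sub x xV); split.
  - split; [split|].
    + by rewrite -(size_map val) cFE.
    + rewrite /ucycle uniq_cF andbT; apply: cycle_from_next => // v.
      rewrite mem_cF => vc; rewrite /= /eV /e next_cF eqxx !orbT andbT.
      exact: next_cycle cyc_c vc.
    + move=> u v; rewrite !mem_cF => uc vc /andP[_].
      rewrite (negbTE (memPn xNc _ uc)) (negbTE (memPn xNc _ vc)) /=.
      by case/orP=> /eqP eq_next; [left|right]; apply: val_inj;
        rewrite next_cF.
  - by rewrite mem_cF.
  - move=> v; rewrite mem_cF; have:= valP v; rewrite inE.
    by case/orP=> [/eqP eq_v|]; [left; apply: val_inj | right].
  - apply/card_gt1P; exists (Sub y (cV y yc)), (Sub z (cV z zc)).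
    split; rewrite ?inE ?mem_cF /= /eV /e /= ?eqxx ?xy ?xz //.
exists [set v in x :: c], (fun u v => [&& u \in x :: c, v \in x :: c & e u v]).
split; first split.
- by move=> u v; rewrite e_sym andbCA.
- by move=> u v /and3P[uc vc /andP[uv _]]; rewrite !in_set.
exists val; split; first exact: val_inj.
- apply/setP=> v; apply/imsetP/idP => [[u _ ->]|].
    by rewrite in_set (valP u).
  by rewrite in_set => vc; exists (Sub v vc).
- by move=> u v; rewrite !(valP u) !(valP v).
Qed.

(** * Rerouting a cycle through a new node *)

Lemma splice_cycle (T : eqType) (e : rel T) u s1 q s2 z p :
  ucycle e (u :: s1 ++ q :: s2) -> e u z -> path e z (rcons p q) ->
  uniq (z :: p) -> ~~ has (mem (u :: s1 ++ q :: s2)) (z :: p) ->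
  ucycle e (u :: (z :: p) ++ q :: s2).
Proof.
move=> /andP[cyc_c uniq_c] uz zpq uniq_p pNc; apply/andP; split.
  move: cyc_c zpq; rewrite /= !rcons_cat /= !cat_path /=.
  rewrite [path e z (rcons p q)]rcons_path uz.
  by move=> /and3P[_ _ ->] /andP[-> ->].
have sub_c : subseq (u :: q :: s2) (u :: s1 ++ q :: s2).
  by rewrite /= eqxx suffix_subseq.
have /perm_uniq-> : perm_eq (u :: (z :: p) ++ q :: s2)
    ((z :: p) ++ [:: u] ++ q :: s2).
  by rewrite perm_sym perm_catCA.
rewrite cat_uniq uniq_p (subseq_uniq sub_c uniq_c) andbT.
rewrite has_sym; apply: contra pNc.
by apply: sub_has => v /(mem_subseq sub_c).
Qed.

(** The path from [z] is cut at its first node [q] on the cycle, and [q] differs from [u]. Of the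
    two arcs between [u] and [q], one that contains [y] is kept and the other is replaced by the
    detour through [z]. *)
Lemma extend_cycle (T : eqType) (e : rel T) c u y z p :
  symmetric e -> ucycle e c -> u \in c -> y \in c -> z \notin c -> e u z ->
  path e z p -> uniq (z :: p) -> last z p = y -> u \notin p ->
  exists c', [/\ ucycle e c', 2 < size c', y \in c' & z \in c'].
Proof.
move=> e_sym cyc_c /rot_to[i s rot_c] yc zNc uz zp uniq_p last_p uNp.
have{cyc_c} cyc_s : ucycle e (u :: s) by rewrite -rot_c rot_ucycle.
have{zNc} zNs : z \notin u :: s by rewrite -rot_c mem_rot.
have{rot_c yc} yus : y \in u :: s by rewrite -rot_c mem_rot.
have zNy : z != y by apply: contraNneq zNs => ->.
have yp : y \in p.
  by have:= mem_last z p; rewrite last_p inE eq_sym (negbTE zNy).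
have ys : y \in s.
  by move: yus; rewrite inE => /orP[/eqP yu|//]; rewrite -yu yp in uNp.
have p_meets_s : has (mem (u :: s)) p by apply/hasP; exists y.
case: (split_find p_meets_s) zp uniq_p uNp => q p1 p2 qs p1Ns.
rewrite cat_path -cat_cons cat_uniq mem_cat !negb_or mem_rcons inE negb_or.
move=> /andP[zp1 _] /andP[uniq_p1 _] /andP[/andP[uq _] _].
have{}uniq_p1 : uniq (z :: p1).
  by move: uniq_p1; rewrite -rcons_cons rcons_uniq => /andP[].
have{}qs : q \in s by move: qs; rewrite /= inE eq_sym (negbTE uq).
have zp1Ns : ~~ has (mem (u :: s)) (z :: p1).
  by rewrite /= negb_or; apply/andP.
(* If [y] lies on the arc that would be dropped, the cycle is traversed backwards, which puts [y]
   behind [q]. *)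
have [s1 [s2 [cyc_s' s_s' ys2]]] : exists s1 s2,
    [/\ ucycle e (u :: s1 ++ q :: s2), s1 ++ q :: s2 =i s & y \in q :: s2].
  case/splitPr: qs ys cyc_s {zNs yus p_meets_s p1Ns zp1Ns} => s1 s2.
  rewrite mem_cat => /orP[ys1|ys2] cyc_s; last by exists s1, s2.
  have rev_s : rev s2 ++ q :: rev s1 = rev (s1 ++ q :: s2).
    by rewrite rev_cat rev_cons cat_rcons.
  exists (rev s2), (rev s1); rewrite inE mem_rev ys1 orbT rev_s; split=> //.
    move: cyc_s => /andP[cyc_s uniq_s]; rewrite /ucycle -rev_rcons rev_cycle.
    rewrite rev_uniq rcons_uniq -cons_uniq uniq_s andbT -rot1_cons rot_cycle.
    by rewrite (eq_cycle (e' := e)) // => v w; rewrite e_sym.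
  by move=> v; rewrite mem_rev.
exists (u :: (z :: p1) ++ q :: s2); split.
- apply: splice_cycle cyc_s' _ _ _ _ => //.
  by rewrite (eq_has (a2 := mem (u :: s))) // => v; rewrite /= !inE s_s'.
- by rewrite /= size_cat /= addnS.
- by rewrite inE mem_cat ys2 !orbT.
- by rewrite !inE eqxx orbT.
Qed.

(** * Paths and connectivity after deleting nodes *)

Section AdjacencyAvoidingASet.

Variable G : sgraph.
Implicit Types (u v w x y z : G) (S : {set G}) (c p s : seq G).

(** Adjacency in [G - S], kept on the node type of [G] with the nodes of [S] isolated, so that
    different sets [S] are compared without changing types. *)
Definition avoid S : rel G :=
  fun u v => [&& u \notin S, v \notin S & adj u v].

Lemma avoid_sym S : symmetric (avoid S).
Proof. by move=> u v; rewrite /avoid andbCA adj_sym. Qed.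

Lemma avoid_adj S : subrel (avoid S) (@adj G).
Proof. by move=> u v /and3P[]. Qed.

Lemma avoid_sub S S' : S \subset S' -> subrel (avoid S') (avoid S).
Proof.
move=> /subsetP sSS' u v /and3P[uS vS uv]; apply/and3P; split=> //.
  by apply: contra uS; apply: sSS'.
by apply: contra vS; apply: sSS'.
Qed.

Lemma path_avoid_notin S u p :
  path (avoid S) u p -> {in p, forall v, v \notin S}.
Proof.
elim: p u => //= v p IHp u /andP[/and3P[_ vS _] /IHp pS] w.
by rewrite inE => /orP[/eqP->//|/pS].
Qed.

Lemma path_avoidU1 S w u p :
  path (avoid S) u p -> w \notin u :: p -> path (avoid (w |: S)) u p.
Proof.
elim: p u => //= v p IHp u /andP[/and3P[uS vS uv] vp].
rewrite inE negb_or => /andP[wu wvp]; rewrite IHp // andbT /avoid uv.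
move: wvp; rewrite inE negb_or => /andP[wv _].
by rewrite !in_setU1 !negb_or uS vS ![_ == w]eq_sym wu wv.
Qed.

Lemma connect_uniq_path S u v : connect (avoid S) u v ->
  exists p, [/\ path (avoid S) u p, uniq (u :: p) & last u p = v].
Proof. by case/connectP=> p up ->; case: (shortenP up) => p' *; exists p'. Qed.

Lemma cycle_avoid S c : ucycle (avoid S) c -> 2 < size c ->
  is_cycle c /\ {in c, forall v, v \notin S}.
Proof.
move=> /andP[cyc_c uniq_c] size_c; split.
  by split=> //; rewrite /ucycle uniq_c (sub_cycle (@avoid_adj S) cyc_c).
by move=> v /(next_cycle cyc_c)/and3P[].
Qed.

(** Induction along the path, as in Whitney's theorem on 2-connected graphs: a cycle through [y] and
    [u] is extended to [z]. An inner node [u] is required, since for adjacent [y] and [z] the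
    hypothesis on [w] holds even if [yz] is a bridge. *)
Lemma not_separated_cycle S y p u z :
  path (avoid S) y (rcons (rcons p u) z) ->
  uniq (y :: rcons (rcons p u) z) ->
  (forall w, w != y -> w != z -> connect (avoid (w |: S)) y z) ->
  exists c, [/\ ucycle (avoid S) c, 2 < size c, y \in c & z \in c].
Proof.
elim/last_ind: p u z => [|p t IHp] u z.
  rewrite /= !inE !negb_or => /and3P[yu uz _] /and3P[/andP[yu' yz] uz' _] nsep.
  have uy : u != y by rewrite eq_sym.
  have := nsep u uy uz'; rewrite (sym_connect_sym (@avoid_sym _)).
  case/connect_uniq_path=> p [zp uniq_p last_p].
  have uNp : u \notin p.
    by apply/negP=> /(path_avoid_notin zp); rewrite setU11.
  have yp : y \in p.
    by have := mem_last z p; rewrite last_p inE (negbTE yz).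
  exists (u :: z :: p); split.
  - apply/andP; split.
      rewrite /= uz rcons_path last_p yu andbT.
      exact: sub_path (avoid_sub (subsetUr _ _)) _ _ zp.
    by rewrite cons_uniq inE negb_or uz' uNp.
  - by case: (p) yp.
  - by rewrite !inE yp !orbT.
  - by rewrite !inE eqxx orbT.
rewrite rcons_path last_rcons => /andP[yu uz].
rewrite -rcons_cons rcons_uniq => /andP[zNu uniq_u] nsep.
have uNy : u != y.
  by move: uniq_u; rewrite /= mem_rcons inE eq_sym negb_or => /andP[/andP[]].
have uz' : u != z.
  by apply: contraNneq zNu => <-; rewrite inE mem_rcons mem_head orbT.
have [|c [cyc_c size_c yc uc]] := IHp _ _ yu uniq_u.
  (* No [w] separates [y] from [u]: the path up to [u] avoids [z], and for any other [w] the edge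
     [zu] prolongs a connection from [y] to [z]. *)
  move=> w wy wu; have [->|wz] := eqVneq w z.
    apply/connectP; exists (rcons (rcons p t) u); rewrite ?last_rcons //.
    exact: path_avoidU1.
  apply: connect_trans (nsep w wy wz) (connect1 _).
  rewrite avoid_sym; case/and3P: uz => uS zS uz.
  by rewrite /avoid !in_setU1 !negb_or uS zS uz ![_ == w]eq_sym wu wz.
have [zc|zNc] := boolP (z \in c); first by exists c.
have := nsep u uNy uz'; rewrite (sym_connect_sym (@avoid_sym _)).
case/connect_uniq_path=> q [zq uniq_q last_q].
have uNq : u \notin q.
  by apply/negP=> /(path_avoid_notin zq); rewrite setU11.
apply: (extend_cycle _ cyc_c uc yc zNc uz _ uniq_q last_q uNq).
  exact: avoid_sym.
exact: sub_path (avoid_sub (subsetUr _ _)) _ _ zq.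
Qed.

Lemma adj_neq u v : adj u v -> u != v.
Proof. by apply: contraTneq => ->; rewrite adj_irr. Qed.

(** A path in [G - a] from a third neighbor [d] of [a] to [b], cut at its first node [t] in
    [[set b; c]], closes up through [a]. The other node of [[set b; c]] is off this cycle and
    adjacent to both [a] and [t], so it serves as center. *)
Lemma triangle_propeller (a b c : G) :
  (forall u v, u != a -> v != a -> connect (avoid [set a]) u v) ->
  adj a b -> adj a c -> adj b c -> 2 < degree a -> contains_propeller G.
Proof.
move=> conn_a ab ac bc deg_a.
have [d ad dNbc] : exists2 d, adj a d & d \notin [set b; c].
  have /subsetPn[d] : ~~ (nbrs a \subset [set b; c]).
    apply: contraL deg_a => /subset_leq_card; rewrite -leqNgt => /leq_trans.
    by apply; rewrite cards2; case: eqP.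
  by rewrite inE; exists d.
have [||p [dp uniq_p last_p]] := connect_uniq_path (conn_a d b _ _).
- by rewrite eq_sym adj_neq.
- by rewrite eq_sym adj_neq.
have p_meets : has (mem [set b; c]) p.
  apply/hasP; exists b; last by rewrite /= set21.
  have := mem_last d p; rewrite last_p inE => /orP[/eqP bd|//].
  by rewrite -bd set21 in dNbc.
case: (split_find p_meets) dp uniq_p => t p1 p2 /= tbc p1N.
rewrite cat_path mem_cat negb_or cat_uniq.
move=> /andP[dp1 _] /andP[/andP[dNp1 _] /andP[uniq_p1 _]].
pose C := a :: d :: rcons p1 t.
have aNp1 : a \notin rcons p1 t.
  by apply/negP=> /(path_avoid_notin dp1); rewrite set11.
have a_t : adj a t by move: tbc; rewrite !inE => /orP[]/eqP->.
have cycC : is_cycle C.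
  split; first by rewrite /= size_rcons.
  apply/andP; split.
    rewrite /= rcons_path last_rcons ad adj_sym a_t andbT.
    exact: sub_path (@avoid_adj _) _ _ dp1.
  by rewrite /= inE negb_or adj_neq // aNp1 dNp1.
have notinC t' : t' \in [set b; c] -> t' != t -> t' \notin C.
  move=> t'bc t't; rewrite !inE mem_rcons inE !negb_or t't; apply/and3P; split.
  - by rewrite eq_sym adj_neq //; move: t'bc; rewrite !inE => /orP[]/eqP->.
  - by apply: contraNneq dNbc => <-.
  - by apply: contra p1N => t'p1; apply/hasP; exists t'.
have aC : a \in C by rewrite mem_head.
have tC : t \in C by rewrite !inE mem_rcons mem_head !orbT.
have aNt := adj_neq a_t.
have cb : adj c b by rewrite adj_sym.
have ca : adj c a by rewrite adj_sym.
have ba : adj b a by rewrite adj_sym.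
case/set2P: tbc => t_eq; rewrite t_eq in tC aNt notinC.
  have cNC := notinC c (set22 _ _) (adj_neq cb).
  exact: cycle_propeller cycC cNC aC tC aNt ca cb.
have bNC := notinC b (set21 _ _) (adj_neq bc).
exact: cycle_propeller cycC bNC aC tC aNt ba bc.
Qed.

(** * Cutsets, splits and chordless sides *)

Lemma split_node_cutset S (C1 C2 : {set G}) : is_split S C1 C2 -> node_cutset S.
Proof.
move=> [/set0Pn[u uC1] /set0Pn[v vC2] disC eqC noE].
have uS : u \in ~: S by rewrite -eqC inE uC1.
have vS : v \in ~: S by rewrite -eqC inE vC2 orbT.
pose e := @adj (induced (~: S)).
have sym_e : connect_sym e by apply: sym_connect_sym; apply: adj_sym.
pose u' : induced (~: S) := Sub u uS.
pose v' : induced (~: S) := Sub v vS.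
have closed_C1 : closed e [pred w | val w \in C1].
  apply: intro_closed => // s t st; rewrite !inE => sC1.
  have /setP/(_ (val t)) := eqC; rewrite (valP t) inE => /orP[//|tC2].
  by have := noE _ _ sC1 tC2; rewrite (st : adj (val s) (val t)).
apply/card_gt1P; exists (root e u'), (root e v').
split; rewrite ?inE ?roots_root //.
rewrite root_connect //; apply/negP=> /(closed_connect closed_C1).
by rewrite !inE /= uC1 (disjointFl disC vC2).
Qed.

Lemma separated_split S u v :
  u \notin S -> v \notin S -> ~~ connect (avoid S) u v ->
  exists C1 C2 : {set G}, [/\ is_split S C1 C2, u \in C1 & v \in C2].
Proof.
move=> uS vS Nuv.
pose C := [set w | (w \notin S) && connect (avoid S) u w].
pose D := [set w | (w \notin S) && ~~ connect (avoid S) u w].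
have uC : u \in C by rewrite inE uS connect0.
have vD : v \in D by rewrite inE vS Nuv.
exists C, D; split=> //; split.
- by apply/set0Pn; exists u.
- by apply/set0Pn; exists v.
- rewrite -setI_eq0; apply/eqP/setP=> w; rewrite !inE.
  by case: connect; rewrite ?andbF.
- by apply/setP=> w; rewrite !inE -andb_orr orbN andbT.
- move=> s t; rewrite !inE => /andP[sS us] /andP[tS]; apply: contra => st.
  by apply: connect_trans us (connect1 _); rewrite /avoid sS tS.
Qed.

Lemma inner_node_degree (W : {set G}) a b y :
  induces_chordless_path W a b -> nbrs y \subset W -> y \in W -> degree y <= 2.
Proof.
move=> [p [_ chordless] ->] /subsetP nbrsW; rewrite inE => yp.
(* These are the successor and the predecessor of [y] on the path. At an end of the path the missing
   one becomes [a], by the default of [nth] or by [0.-1 = 0], which is harmless for an upper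
   bound. *)
have /subset_leq_card/leq_trans : nbrs y \subset
    [set nth a (a :: p) (index y (a :: p)).+1;
         nth a (a :: p) (index y (a :: p)).-1].
  apply/subsetP=> v vy; have := nbrsW v vy; rewrite inE => vp.
  rewrite inE in vy; rewrite !inE -{1 2}(nth_index a vp).
  by case: (chordless y v yp vp vy) => ->; rewrite eqxx ?orbT.
by apply; rewrite cards2; case: eqP.
Qed.

(** Edges leaving [C1] end in [S], so all neighbors of [y] stay in [S :|: C1], where a chordless
    path would allow only two. *)
Lemma split_side_not_path S (C1 C2 : {set G}) a b y :
  is_split S C1 C2 -> y \in C1 -> 2 < degree y ->
  ~ induces_chordless_path (S :|: C1) a b.
Proof.
move=> [_ _ _ eqC noE] yC1 deg_y /inner_node_degree path_deg.
move: deg_y; rewrite ltnNge path_deg ?in_setU ?yC1 ?orbT //.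
apply/subsetP=> v; rewrite inE => yv; rewrite in_setU.
have := in_setC v S; rewrite -eqC in_setU.
case: (v \in S) => //= /orP[//|vC2].
by have := noE _ _ yC1 vC2; rewrite yv.
Qed.

Lemma split_sym S (C1 C2 : {set G}) : is_split S C1 C2 -> is_split S C2 C1.
Proof.
move=> [nzC1 nzC2 disC eqC noE]; split; rewrite 1?disjoint_sym 1?setUC //.
by move=> u v uC2 vC1; rewrite adj_sym noE.
Qed.

End AdjacencyAvoidingASet.

Theorem theorem3p2 (G : sgraph) (hG : ~ contains_propeller G) :
  in_C0 G \/
  (has_k_cutset G 0 \/ has_k_cutset G 1 \/
   has_proper_K2_cutset G \/ has_proper_S2_cutset G).
Proof.
have [/forallP C0|] :=
    boolP [forall x : G, #|[set y in nbrs x | 3 <= degree y]| < 2].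
  by left=> x; apply/negP; rewrite -ltnNge.
rewrite negb_forall => /existsP[x]; rewrite -leqNgt.
case/card_gt1P=> y [z []]; rewrite !inE => /andP[xy deg_y] /andP[xz deg_z] yz.
(* A disconnected [G] is covered by a 1-cutset: deleting [x] leaves [y] in its component and spares
   the other components. *)
right; right.
have [conn|] := boolP [forall a : G, forall u : G, forall v : G,
    (u != a) ==> (v != a) ==> connect (avoid [set a]) u v]; last first.
  rewrite negb_forall => /existsP[a]; rewrite negb_forall => /existsP[u].
  rewrite negb_forall => /existsP[v]; rewrite !negb_imply => /and3P[ua va Nuv].
  left; exists [set a]; split; last exact: cards1.
  have [||C1 [C2 [split_a _ _]]] := separated_split _ _ Nuv; rewrite ?inE //.
  exact: split_node_cutset split_a.
have {}conn (a u v : G) : u != a -> v != a -> connect (avoid [set a]) u v.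
  move=> ua va; move/forallP/(_ a)/forallP/(_ u)/forallP/(_ v): conn.
  by rewrite ua va.
right.
have triangle a b c := @triangle_propeller G a b c (conn a).
have yx : y != x by rewrite eq_sym adj_neq.
have zx : z != x by rewrite eq_sym adj_neq.
(* Otherwise [y], [x], [z] form a triangle with [y] of degree at least three. Hence every path from
   [y] to [z] has an inner node. *)
have Nyz : ~~ adj y z.
  apply/negP=> yz_adj; apply: hG.
  by apply: (triangle y x z); rewrite // adj_sym.
have [/forallP nsep|] := boolP [forall w : G,
    (w != y) ==> (w != z) ==> connect (avoid (w |: [set x])) y z].
  case: hG; have [p [yp uniq_p last_p]] := connect_uniq_path (conn x y z yx zx).
  have [c [cyc_c size_c yc zc]] : exists c,
      [/\ ucycle (avoid [set x]) c, 2 < size c, y \in c & z \in c].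
    case/lastP: p => [|p t] in yp uniq_p last_p *.
      by rewrite -last_p /= eqxx in yz.
    rewrite last_rcons in last_p; rewrite {}last_p in yp uniq_p.
    case/lastP: p => [|p u] in yp uniq_p *.
      by case/andP: yp => /and3P[_ _]; rewrite (negbTE Nyz).
    apply: not_separated_cycle yp uniq_p _ => w wy wz.
    by have := nsep w; rewrite wy wz.
  have [cyc cNx] := cycle_avoid cyc_c size_c.
  apply: (cycle_propeller cyc _ yc zc yz xy xz).
  by apply/negP=> /cNx; rewrite set11.
rewrite negb_forall => /existsP[w]; rewrite !negb_imply => /and3P[wy wz Nyz_w].
have wx : w != x.
  by apply: contraNneq Nyz_w => ->; rewrite setUid; apply: conn.
rewrite setUC in Nyz_w.
have [||C1 [C2 [split_xw yC1 zC2]]] := separated_split _ _ Nyz_w.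
- by rewrite !inE negb_or yx eq_sym.
- by rewrite !inE negb_or zx eq_sym.
have cut_xw : k_cutset 2 [set x; w].
  by split; [exact: split_node_cutset split_xw | rewrite cards2 eq_sym wx].
have [xw|Nxw] := boolP (adj x w).
  left; exists x, w; split=> // v _ [vx vw]; apply: hG.
  apply: (triangle x w v); rewrite // 1?adj_sym //.
  (* With [xw] an edge, [w], [y] and [z] are three distinct neighbors of [x]. *)
  apply: (@leq_trans #|w |: [set y; z]|).
    by rewrite cardsU1 cards2 !inE negb_or wy wz yz.
  by apply/subset_leq_card/subsetP=> u; rewrite !inE => /or3P[] /eqP->.
right; exists x, w; split=> //; exists C1, C2; split=> //.
  exact: split_side_not_path split_xw yC1 deg_y.
exact: split_side_not_path (split_sym split_xw) zC2 deg_z.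
Qed.
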